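(* Let $c,\sigma>0$ and $0<\epsilon\le1$, and let a Runge-Kutta method with matrix $G$ and weights $w$ be applied, with time step $\tau$, to the Fourier-side systems (S1), (S2), (S3) of the context (which depend on $\epsilon$), for all $k\in[N]^*\setminus\{0\}$, where $h=2\pi/N$. Let $e$ be the vector of ones, $\nu=c\sigma|k|/\epsilon$, and $$\psi(\tau,\nu)=\sqrt{\frac{\left|\det\left(I+\tau^2\nu(G-ew^T)^2\right)\right|}{\left|\det\left(I+\tau^2\nu G^2\right)\right|}} .$$ 1. For any Runge-Kutta method, if the CFL condition $\tau\le \epsilon Ch$ holds for some positive real number $C$ independent of $\epsilon$ (and of $\tau$, $h$), then the scheme for each of the systems (S1), (S2), (S3) is stable. More specifically, as $\tau\to0$ with $\tau\le\epsilon Ch$, uniformly in such $h$ and in $k\in[N]^*\setminus\{0\}$: (a) if $\mathrm{tr}(G^2)>\mathrm{tr}\left((G-ew^T)^2\right)$, then $\psi(\tau,\nu)<1$ for all sufficiently small $\tau$ (strong stability); (b) if $\mathrm{tr}(G^2)\le\mathrm{tr}\left((G-ew^T)^2\right)$, then $\psi(\tau,\nu)\le 1+L\tau+O(\tau^2)$ for some constant $L$ with $0\le L\le \mathrm{tr}\left((G-ew^T)^2-G^2\right)\dfrac{c\sigma C\pi}{2\epsilon}$ (weak stability). 2. For any Runge-Kutta method whose absolute stability region contains a segment $[-C_1i,C_1i]$ of the imaginary axis with $C_1>0$, there exists $C_2>0$ (independent of $\epsilon$, $\tau$ and $h$) such that whenever $\tau\le C_2\sqrt{\epsilon h}$, the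 scheme is strongly stable.
   Context: $N$ is an even positive integer, $h=2\pi/N$ is the spatial grid size, and $[N]^*=\{-\tfrac N2+1,\dots,\tfrac N2\}$ is the set of discrete Fourier modes. The parameter $\epsilon\in(0,1]$ is a small scaled wavelength. The rescaled (high frequency) nonlocal hyperbolic system is $u_t=\sigma\Lambda v$, $\epsilon v_t=-cu$, with constants $\sigma,c>0$ and $\Lambda=(-\Delta)^{1/2}$ the operator with Fourier symbol $|k|$, with periodic boundary conditions. It is discretized in space by the Fourier spectral method. For each mode $k$ this gives (S1) $\partial_t(\hat u,\hat v)^T=A_1(\hat u,\hat v)^T$, with $A_1=\begin{pmatrix}0&\sigma|k|\\-c/\epsilon&0\end{pmatrix}$. With $\hat w=\sqrt{\epsilon\sigma|k|/c}\,\hat v$ (for $k\ne0$) it becomes (S2) $\partial_t(\hat u,\hat w)^T=Q(\hat u,\hat w)^T$, with $Q=\begin{pmatrix}0&\sqrt{\nu}\\-\sqrt{\nu}&0\end{pmatrix}$ and $\nu=c\sigma|k|/\epsilon$, and diagonalizing $Q$, whose eigenvalues are $\pm i\sqrt\nu$, gives (S3) $\partial_t(\hat u_1,\hat v_1)^T=\mathrm{diag}(i\sqrt\nu,-i\sqrt\nu)(\hat u_1,\hat v_1)^T$. A Runge-Kutta (RK) method is given by its Butcher tableau, with real square matrix $G$ and real weight vector $w$. Applied to $y'=\lambda y$ with time step $\tau$ it reads $y_{n+1}=f(\tau\lambda)y_n$, where $f(z)=1+zw^T(I-zG)^{-1}e$. Its absolute stability region is $\{z\in\mathbb{C}:|f(z)|\le1\}$.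 The growth matrix of an RK method for one of the systems is the matrix mapping the numerical solution at step $n$ to that at step $n+1$. Growth is measured in the Euclidean norm for (S2) and (S3), and, through the change of variables from (S1) to (S2), in the norm $(|\hat u|^2+\tfrac{\epsilon\sigma|k|}{c}|\hat v|^2)^{1/2}$ for (S1). The quantity $\psi(\tau,\nu)$ is the growth factor, that is, the common modulus of the two eigenvalues of the growth matrix. The scheme is strongly stable if the norm of the growth matrix is at most $1$ for all $k$. It is (weakly) stable if this norm is at most $1+L\tau+O(\tau^2)$ with $L\geq 0$ and the $O(\tau^2)$ term uniform in $k$ and $h$. *)

(* Defs.v *)
From HB Require Import structures.
From mathcomp Require Export all_boot all_order all_algebra.
From mathcomp Require Export all_classical all_reals all_analysis.
From mathcomp Require Export complex.

Set Implicit Arguments.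
Unset Strict Implicit.
Unset Printing Implicit Defensive.

Export Order.TTheory GRing.Theory Num.Theory.
Export numFieldNormedType.Exports.

#[global] Open Scope classical_set_scope.
#[global] Open Scope ring_scope.
#[global] Open Scope complex_scope.

Section Norms.
Variable R : realType.

Definition weighted_norm (a : R) (x : 'cV[R[i]]_2) : R :=
  Num.sqrt (ComplexField.Normc.normc (x 0 0) ^+ 2
            + a * ComplexField.Normc.normc (x 1 0) ^+ 2).

(* Operator norm induced by [nrm].  The supremum is over a nonempty set, which
   is bounded when [nrm] is a norm; this is the case for [weighted_norm a] with
   [0 < a], the only instances used below. *)
Definition op_norm (nrm : 'cV[R[i]]_2 -> R) (M : 'M[R[i]]_2) : R :=
  sup [set nrm (M *m x) | x in [set x | nrm x <= 1]].

End Norms.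

Section RungeKutta.
Variables (R : realType) (s : nat) (G : 'M[R]_s) (w : 'cV[R]_s).

Definition ones : 'cV[R]_s := const_mx 1.

(* [f(z) = 1 + z w^T (I - z G)^{-1} e]; only meaningful when [I - z G] is
   invertible, since [invmx] is the identity on singular matrices. *)
Definition rk_fun (z : R[i]) : R[i] :=
  let toC m n := @map_mx _ _ (real_complex R) m n in
  1 + z * ((toC _ _ w)^T *m invmx (1%:M - z *: toC _ _ G) *m toC _ _ ones) 0 0.

Definition stability_region : set R[i] :=
  [set z | (1%:M - z *: map_mx (real_complex R) G \in unitmx)
           /\ ComplexField.Normc.normc (rk_fun z) <= 1].

(* Column [i] of [Y] is the [i]-th stage of a step of size [tau] from [y], for
   the linear system y' = A y. *)
Definition rk_stages (tau : R) (A : 'M[R[i]]_2) (y : 'cV[R[i]]_2)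
    (Y : 'M[R[i]]_(2, s)) : Prop :=
  forall i, col i Y = y + tau%:C *: \sum_j (G i j)%:C *: (A *m col j Y).

Definition rk_update (tau : R) (A : 'M[R[i]]_2) (y : 'cV[R[i]]_2)
    (Y : 'M[R[i]]_(2, s)) : 'cV[R[i]]_2 :=
  y + tau%:C *: \sum_i (w i 0)%:C *: (A *m col i Y).

(* [M] maps the numerical solution at one step to that at the next; the stage
   equations are required to be uniquely solvable, so that the step is
   well defined and [M] is determined by the method and the system. *)
Definition growth_matrix (tau : R) (A M : 'M[R[i]]_2) : Prop :=
  forall y, (exists! Y, rk_stages tau A y Y)
    /\ forall Y, rk_stages tau A y Y -> M *m y = rk_update tau A y Y.

(* [psi (tau, nu)], with [tau] and [nu] as separate arguments. *)
Definition psi (tau nu : R) : R :=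
  let B := G - ones *m w^T in
  Num.sqrt (`|\det (1%:M + (tau ^+ 2 * nu) *: (B *m B))|
            / `|\det (1%:M + (tau ^+ 2 * nu) *: (G *m G))|).

End RungeKutta.

Definition grid_size (R : realType) (N : nat) : R := 2 * pi / N%:R.

(* The modes -N/2 + 1, ..., N/2, without 0. *)
Definition nonzero_mode (N : nat) (k : int) : Prop :=
  (- (N./2)%:Z + 1 <= k <= (N./2)%:Z) /\ k != 0.

Inductive fourier_system := S1 | S2 | S3.

Section Systems.
Variables (R : realType) (c sigma eps : R) (k : int).

Definition absk : R := `|k|%:~R.

Definition freq : R := c * sigma * absk / eps.

Definition mx2 (a b a' b' : R[i]) : 'M[R[i]]_2 :=
  \matrix_(i, j) if i == 0 then (if j == 0 then a else b)
                 else (if j == 0 then a' else b').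

Definition system_mx (S : fourier_system) : 'M[R[i]]_2 :=
  match S with
  | S1 => mx2 0 (sigma * absk)%:C (- (c / eps))%:C 0
  | S2 => mx2 0 (Num.sqrt freq)%:C (- Num.sqrt freq)%:C 0
  | S3 => mx2 (0 +i* Num.sqrt freq) 0 0 (0 -i* Num.sqrt freq)
  end.

(* For [S1], the Euclidean norm of (u, w) with w = sqrt (eps sigma |k| / c) v. *)
Definition system_norm (S : fourier_system) : 'cV[R[i]]_2 -> R :=
  match S with
  | S1 => weighted_norm (eps * sigma * absk / c)
  | S2 | S3 => weighted_norm 1
  end.

End Systems.

Section Stability.
Variables (R : realType) (s : nat) (G : 'M[R]_s) (w : 'cV[R]_s).
Variables (c sigma eps : R).

Definition growth_le (S : fourier_system) (tau : R) (N : nat) (b : R) : Prop :=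
  forall k, nonzero_mode N k ->
    exists M, growth_matrix G w tau (system_mx c sigma eps k S) M
      /\ op_norm (system_norm c sigma eps k S) M <= b.

Definition strongly_stable S (tau : R) (N : nat) : Prop :=
  growth_le S tau N 1.

(* [P tau N] for all sufficiently small [tau > 0], uniformly in the grids
   satisfying [tau <= eps C h]. *)
Definition small_step_cfl (C : R) (P : R -> nat -> Prop) : Prop :=
  \forall tau \near 0^'+, forall N : nat, (0 < N)%N -> ~~ odd N ->
    tau <= eps * C * grid_size R N -> P tau N.

(* [K] is the constant of the O(tau^2) term. *)
Definition stable_under_cfl (C : R) (S : fourier_system) : Prop :=
  exists L K : R, 0 <= L /\
    small_step_cfl C (fun tau N => growth_le S tau N (1 + L * tau + K * tau ^+ 2)).

End Stability.

(* Main.v *)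
(* Each of the three system matrices satisfies A^2 = - nu I, so that with
   x = tau^2 nu the stage equations reduce to inverting the real matrix
   I + x G^2, and the growth matrix is a I + tau b A, where
   f(i sqrt x) = a + i (sqrt x) b.  As A is skew-adjoint for the norm of its
   system, the growth matrix multiplies that norm by
   sqrt (a^2 + x b^2) = |f(i sqrt x)|.  The matrix determinant lemma gives
   f(z) = det (I - z B) / det (I - z G) with B = G - e w^T, hence this factor is
   psi.  The first part follows from det (I + x M) = 1 + x tr M + O(x^2) and
   x <= c sigma C pi tau, the second from sqrt x <= C1. *)
Require Import Defs.
From mathcomp Require Import ring lra.

Set Implicit Arguments.
Unset Strict Implicit.
Unset Printing Implicit Defensive.

(** * Determinant identities and expansion of det (I + x A) at x = 0 *)

(** Sylvester's identity: both sides are the determinant of one block matrix, factored into block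
    triangular matrices in two ways. *)
Lemma det_addmx_mulC (R : comPzRingType) (m n : nat) (A : 'M[R]_(m, n)) (B : 'M[R]_(n, m)) :
  \det (1%:M + A *m B) = \det (1%:M + B *m A).
Proof.
have EL : block_mx 1%:M (- A) B 1%:M
    = block_mx 1%:M 0 B 1%:M *m block_mx 1%:M (- A) 0 (1%:M + B *m A).
  by rewrite mulmx_block !mul1mx !mul0mx !mulmx1 ?mulmx0 ?addr0 ?add0r mulmxN addrC addrK.
have EU : block_mx 1%:M (- A) B 1%:M
    = block_mx (1%:M + A *m B) (- A) 0 1%:M *m block_mx 1%:M 0 B 1%:M.
  by rewrite mulmx_block !mul1mx !mul0mx !mulmx1 ?mulmx0 ?add0r ?addr0 mulNmx addrK.
move: EL; rewrite EU => /(congr1 (@determinant R _)).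
by rewrite !det_mulmx !det_lblock !det_ublock !det1 !mulr1 !mul1r.
Qed.

Lemma det_1addZ_expansion (R : realFieldType) (n : nat) (A : 'M[R]_n) :
  exists K : R, 0 <= K /\ forall x : R, 0 < x <= 1 ->
    `|\det (1%:M + x *: A) - 1 - x * \tr A| <= K * x ^+ 2.
Proof.
case: n A => [|n] A.
  exists 0; split=> // x _; rewrite det_mx00 /mxtrace big_ord0 mulr0.
  by rewrite subrr subr0 normr0 mul0r.
(* det (1 + x A) = x^(n+1) p(1/x) with p the characteristic polynomial of - A. *)
pose p := char_poly (- A).
have dE x : x != 0 -> \det (1%:M + x *: A) = \sum_(i < n.+2) p`_i * x ^+ (n.+1 - i).
  move=> x0.
  have -> : 1%:M + x *: A = x *: (x^-1%:M - - A).
    by rewrite opprK scalerDr scale_scalar_mx mulfV.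
  rewrite detZ.
  have -> : \det (x^-1%:M - - A) = p.[x^-1].
    rewrite /p /char_poly -[LHS]/(\det _) -horner_evalE -det_map_mx; congr (\det _).
    apply/matrixP=> i j; rewrite !mxE /= /horner_eval !hornerE; case: eqP => _ /=;
    by rewrite ?mulr1n ?mulr0n !hornerE.
  rewrite (horner_coef_wide (n:=n.+2)) ?size_char_poly // mulr_sumr.
  apply: eq_bigr => i _.
  have ilt : (i <= n.+1)%N by rewrite -ltnS.
  by rewrite mulrCA exprVn -expfB_cond ?(negPf x0) //; congr (_ * _).
(* The two top coefficients of [p] give 1 and x tr A. Each other coefficient multiplies a power of x
   of exponent at least 2, which is at most x^2 because x <= 1. *)
exists (\sum_(i < n) `|p`_i|); split; first exact: sumr_ge0.
move=> x /andP[x0 x1]; rewrite dE ?gt_eqF //.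
rewrite !big_ord_recr /= subnn subSnn expr0 expr1 mulr1.
have -> : p`_n.+1 = 1.
  by have /monicP := char_poly_monic (- A); rewrite lead_coefE size_char_poly.
have -> : p`_n = \tr A.
  by have := char_poly_trace (- A) isT; rewrite /= => ->; rewrite linearN opprK.
rewrite addrK [\tr A * x]mulrC addrK.
rewrite mulr_suml; apply: le_trans (ler_norm_sum _ _ _) _.
apply: ler_sum => i _; rewrite normrM (ger0_norm (exprn_ge0 _ (ltW x0))) ler_wpM2l //.
by apply: ler_wiXn2l; rewrite ?(ltW x0) // ltn_subRL addn1 ltnS.
Qed.

Lemma det_1addZ_expansion2 (R : realFieldType) (n : nat) (A B : 'M[R]_n) :
  exists K : R, [/\ 0 <= K,
    forall x : R, 0 < x <= 1 ->
      `|\det (1%:M + x *: A) - 1 - x * \tr A| <= K * x ^+ 2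
    & forall x : R, 0 < x <= 1 ->
      `|\det (1%:M + x *: B) - 1 - x * \tr B| <= K * x ^+ 2].
Proof.
have [KA [KA0 HA]] := det_1addZ_expansion A.
have [KB [KB0 HB]] := det_1addZ_expansion B.
exists (KA + KB); split=> [|x x01|x x01]; first exact: addr_ge0.
  by apply: le_trans (HA x x01) _; rewrite ler_wpM2r ?sqr_ge0 // lerDl.
by apply: le_trans (HB x x01) _; rewrite ler_wpM2r ?sqr_ge0 // lerDr.
Qed.

(** * One step for a system with A^2 = - nu I, and f on the imaginary axis *)

Section Growth.
Variables (R : realType) (s : nat) (G : 'M[R]_s) (w : 'cV[R]_s).
Local Notation toC := (map_mx (real_complex R)).

Definition stab_res (x : R) : 'M[R]_s := invmx (1%:M + x *: (G *m G)).
(** [stab_re] and [stab_im] are the a and b of f(i sqrt x) = a + i (sqrt x) b, read off from (I - z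
    G)^{-1} = (I + z G)(I + x G^2)^{-1} at z = i sqrt x. Taking sqrt x out of the imaginary part
    leaves expressions rational in x. *)
Definition stab_re (x : R) : R := 1 - x * (w^T *m G *m stab_res x *m ones R s) 0 0.
Definition stab_im (x : R) : R := (w^T *m stab_res x *m ones R s) 0 0.

(** The stage equations read Y = y E + T Y. Since A^2 = - nu I, the map I - T^2 is right
    multiplication by the transpose of I + x G^2, whose inverse is [H]. Hence I - T is invertible,
    with inverse (I + T)(I - T^2)^{-1}. *)
Lemma growth_matrix_sqr (tau nu : R) (A : 'M[R[i]]_2) :
  A *m A = (- nu)%:C%:M ->
  1%:M + (tau ^+ 2 * nu) *: (G *m G) \in unitmx ->
  growth_matrix G w tau A
    ((stab_re (tau ^+ 2 * nu))%:C%:M + (tau * stab_im (tau ^+ 2 * nu))%:C *: A).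
Proof.
set x := tau ^+ 2 * nu => AA Ux y.
have stagesE Y : rk_stages G tau A y Y
    <-> Y = y *m (toC (ones R s))^T + tau%:C *: (A *m Y *m (toC G)^T).
  have colE i : col i (y *m (toC (ones R s))^T + tau%:C *: (A *m Y *m (toC G)^T))
      = y + tau%:C *: \sum_j (G i j)%:C *: (A *m col j Y).
    apply/colP=> r; rewrite !mxE big_ord1 !mxE mulr1; congr (_ + _ * _).
    rewrite summxE; apply: eq_bigr => j _; rewrite !mxE mulrC; congr (_ * _).
    by apply: eq_bigr => l _; rewrite !mxE.
  split=> [YE|YE i]; last by rewrite -colE -YE.
  by apply/matrixP=> r i; have := YE i; rewrite -colE => /colP/(_ r); rewrite !mxE.
have GG : toC (1%:M + x *: (G *m G)) = 1%:M + x%:C *: (toC G *m toC G).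
  by rewrite map_mxD map_mx1 map_mxZ map_mxM.
pose T (Z : 'M[R[i]]_(2, s)) := tau%:C *: (A *m Z *m (toC G)^T).
have TE (Z : 'M[R[i]]_(2, s)) : tau%:C *: (A *m Z *m (toC G)^T) = T Z by [].
have TB (Z1 Z2 : 'M[R[i]]_(2, s)) : T (Z1 - Z2) = T Z1 - T Z2.
  by rewrite /T mulmxBr mulmxBl scalerBr.
have TT (Z : 'M[R[i]]_(2, s)) : Z - T (T Z) = Z *m (toC (1%:M + x *: (G *m G)))^T.
  rewrite GG linearD /= trmx1 mulmxDr mulmx1; congr (_ + _).
  rewrite /T -scalemxAr -scalemxAl scalerA !mulmxA AA.
  rewrite mul_scalar_mx -!scalemxAl scalerA [(x%:C *: _)^T]linearZ /=.
  rewrite -scalemxAr trmx_mul !mulmxA.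
  rewrite -scaleNr; congr (_ *: _).
  by rewrite /x -!rmorphM -rmorphN /=; congr (_%:C); ring.
set H := (toC (stab_res x))^T.
have HI : (toC (1%:M + x *: (G *m G)))^T *m H = 1%:M.
  by rewrite /H -trmx_mul -map_mxM mulVmx // map_mx1 trmx1.
have IH : H *m (toC (1%:M + x *: (G *m G)))^T = 1%:M.
  by rewrite /H -trmx_mul -map_mxM mulmxV // map_mx1 trmx1.
set E := (toC (ones R s))^T in stagesE.
(* This is (I + T)(I - T^2)^{-1} applied to y E. *)
pose Y0 := y *m E *m H + T (y *m E *m H).
(* Uniqueness: a fixed point of T is also fixed by T^2, hence killed by the invertible map I -
   T^2. *)
have T0 (Z : 'M[R[i]]_(2, s)) : T Z = Z -> Z = 0.
  move=> TZ; have := TT Z; rewrite !TZ subrr => /(congr1 (mulmx^~ H)).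
  by rewrite mul0mx -mulmxA HI mulmx1.
have SY0 : rk_stages G tau A y Y0.
  apply/stagesE; rewrite TE {1}/Y0.
  have -> : T Y0 = T (y *m E *m H) + T (T (y *m E *m H)).
    by rewrite /T /Y0 mulmxDr mulmxDl scalerDr.
  have e : y *m E *m H = y *m E + T (T (y *m E *m H)).
    by apply/eqP; rewrite -subr_eq TT -mulmxA IH mulmx1.
  by rewrite {1}e -addrA; congr (_ + _); rewrite addrC.
have SU (Y : 'M[R[i]]_(2, s)) : rk_stages G tau A y Y -> Y0 = Y.
  move: SY0 => /stagesE; rewrite TE => Y0E /stagesE; rewrite TE => YE.
  apply/subr0_eq/T0.
  by rewrite TB {2}Y0E {2}YE opprD addrACA subrr add0r.
split; first by exists Y0.
move=> Y /SU <-.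
have -> : rk_update w tau A y Y0 = y + tau%:C *: (A *m Y0 *m toC w).
  rewrite /rk_update; congr (_ + _ *: _); apply/colP=> r.
  rewrite summxE !mxE; apply: eq_bigr => j _; rewrite !mxE mulrC; congr (_ * _).
  by apply: eq_bigr => l _; rewrite !mxE.
have sc (a : 'M[R]_1) : (toC a)^T = (a 0 0)%:C%:M.
  by rewrite [a in LHS]mx11_scalar map_scalar_mx tr_scalar_mx.
pose r := (w^T *m G *m stab_res x *m ones R s) 0 0.
have reE : E *m H *m (toC G)^T *m toC w = r%:C%:M.
  by rewrite -sc !map_mxM !trmx_mul -map_trmx trmxK !mulmxA.
have imE : E *m H *m toC w = (stab_im x)%:C%:M.
  by rewrite -sc !map_mxM !trmx_mul -map_trmx trmxK !mulmxA.
(* The first summand of [Y0] gives the term in A y. The second carries another factor A, so A^2 = -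
   nu I turns it into a multiple of y. *)
have -> : A *m Y0 *m toC w
    = (stab_im x)%:C *: (A *m y)
      - (nu * tau * r)%:C *: y.
  rewrite /Y0 /T mulmxDr mulmxDl; congr (_ + _).
    by rewrite -!mulmxA (mulmxA E) imE mul_mx_scalar -scalemxAr.
  rewrite -scalemxAr -scalemxAl !mulmxA AA mul_scalar_mx -!scalemxAl.
  rewrite -!mulmxA !(mulmxA E) !(mulmxA (E *m H)) reE mul_mx_scalar !scalerA -scaleNr.
  congr (_ *: _).
  by rewrite -!rmorphM -rmorphN /=; congr (_%:C); ring.
rewrite mulmxDl mul_scalar_mx -scalemxAl scalerBr !scalerA /stab_re -/r.
rewrite -!rmorphM /= rmorphB /= rmorph1 scalerBl scale1r -addrA; congr (_ + _).
rewrite addrC; congr (_ *: _ - _ *: _); congr (_%:C).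
by rewrite /x /r; ring.
Qed.

(** As A is real, the two factors are complex conjugates of each other. So they are invertible
    together, and det (I + y^2 A^2) is the squared modulus of det (I - i y A). *)
Lemma mulmx_imag_factors (A : 'M[R]_s) (y : R) :
  (1%:M - (0 +i* y) *: toC A) *m (1%:M + (0 +i* y) *: toC A)
  = toC (1%:M + y ^+ 2 *: (A *m A)).
Proof.
rewrite mulmxBl mul1mx mulmxDr mulmx1 opprD addrA addrK -scalemxAl -scalemxAr scalerA.
rewrite map_mxD map_mx1 map_mxZ map_mxM -scaleNr; congr (_ + _ *: _).
by apply/eqP; rewrite eq_complex /=; apply/andP; split; apply/eqP; ring.
Qed.

Lemma imag_factor_conj (A : 'M[R]_s) (y : R) :
  1%:M + (0 +i* y) *: toC A = map_mx (@conjc R) (1%:M - (0 +i* y) *: toC A).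
Proof.
rewrite map_mxD map_mx1 map_mxN map_mxZ; apply/matrixP=> i j; rewrite !mxE.
congr (_ + _); apply/eqP; rewrite eq_complex /=.
by apply/andP; split; apply/eqP; ring.
Qed.

Lemma imag_unitmx (y : R) :
  (1%:M - (0 +i* y) *: toC G \in unitmx)
  = (1%:M + y ^+ 2 *: (G *m G) \in unitmx).
Proof.
rewrite -(map_unitmx (real_complex R)) -mulmx_imag_factors unitmx_mul imag_factor_conj.
by rewrite map_unitmx andbb.
Qed.

Lemma normc_det_imag (A : 'M[R]_s) (y : R) :
  ComplexField.Normc.normc (\det (1%:M - (0 +i* y) *: toC A)) ^+ 2
  = \det (1%:M + y ^+ 2 *: (A *m A)).
Proof.
apply: complexI; rewrite -[RHS]/(real_complex R _) -det_map_mx -mulmx_imag_factors det_mulmx.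
rewrite imag_factor_conj det_map_mx.
case: (\det _) => p q /=; rewrite sqr_sqrtr ?addr_ge0 ?sqr_ge0 //.
by apply/eqP; rewrite eq_complex /=; apply/andP; split; apply/eqP; ring.
Qed.

(** I - z B is a rank-one update of I - z G. Factoring out I - z G leaves I + (I - z G)^{-1} e (z
    w^T), whose determinant reduces by [det_addmx_mulC] to a 1 x 1 one, namely f(z). *)
Lemma rk_fun_det (z : R[i]) : 1%:M - z *: toC G \in unitmx ->
  rk_fun G w z
  = \det (1%:M - z *: toC (G - ones R s *m w^T)) / \det (1%:M - z *: toC G).
Proof.
move=> U; set V := 1%:M - z *: toC G.
have V0 : \det V != 0 by rewrite -unitfE -unitmxE.
rewrite -[LHS](mulfK V0); congr (_ / _).
have -> : 1%:M - z *: toC (G - ones R s *m w^T)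
    = V *m (1%:M + (invmx V *m toC (ones R s)) *m (z *: (toC w)^T)).
  rewrite mulmxDr mulmx1 !mulmxA mulmxV // mul1mx map_mxD map_mxN map_mxM map_trmx.
  by rewrite /V scalerBr opprB addrA addrAC -scalemxAr.
rewrite det_mulmx det_addmx_mulC det_mx11 mulrC; congr (_ * _).
rewrite [RHS]mxE [in RHS]mxE eqxx mulr1n /rk_fun -/V; congr (1 + _).
by rewrite -scalemxAl mulmxA [RHS]mxE.
Qed.

Lemma rk_fun_imag (y : R) : 1%:M + y ^+ 2 *: (G *m G) \in unitmx ->
  rk_fun G w (0 +i* y) = stab_re (y ^+ 2) +i* (y * stab_im (y ^+ 2)).
Proof.
move=> U.
have invE : invmx (1%:M - (0 +i* y) *: toC G)
    = (1%:M + (0 +i* y) *: toC G) *m toC (stab_res (y ^+ 2)).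
  have UV : 1%:M - (0 +i* y) *: toC G \in unitmx by rewrite imag_unitmx.
  rewrite -[RHS](mulKmx UV) (mulmxA (1%:M - _)) mulmx_imag_factors -map_mxM mulmxV //.
  by rewrite map_mx1 mulmx1.
rewrite /rk_fun invE mulmxDl mul1mx -scalemxAl mulmxDr mulmxDl -scalemxAr -scalemxAl.
rewrite map_trmx -!map_mxM !mulmxA /stab_re /stab_im.
set p := w^T *m stab_res _ *m _; set q := w^T *m G *m _ *m _; rewrite !mxE.
by apply/eqP; rewrite eq_complex /=; apply/andP; split; apply/eqP; ring.
Qed.

(** Both sides are |f(i sqrt x)|^2, computed once from real and imaginary parts and once from the
    determinant quotient. *)
Lemma growth_factor_sqr (x : R) : 0 <= x ->
  1%:M + x *: (G *m G) \in unitmx ->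
  stab_re x ^+ 2 + x * stab_im x ^+ 2
  = \det (1%:M + x *: ((G - ones R s *m w^T) *m (G - ones R s *m w^T)))
    / \det (1%:M + x *: (G *m G)).
Proof.
move=> x0 U; rewrite -[x in LHS]sqr_sqrtr // -[x in RHS]sqr_sqrtr //.
have U' : 1%:M - (0 +i* Num.sqrt x) *: toC G \in unitmx.
  by rewrite imag_unitmx sqr_sqrtr.
rewrite -!normc_det_imag -expr_div_n -ComplexField.Normc.normcV.
rewrite -ComplexField.Normc.normcM -rk_fun_det // rk_fun_imag ?sqr_sqrtr ?addr_ge0 ?sqr_ge0 //.
by rewrite exprMn sqr_sqrtr.
Qed.

End Growth.

(** * The three systems and their norms *)

Section Systems.
Variables (R : realType) (c sigma eps : R).
Hypotheses (hc : 0 < c) (hsigma : 0 < sigma) (heps : 0 < eps).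

Lemma absk_gt0 (k : int) : k != 0 -> 0 < absk R k.
Proof. by move=> k0; rewrite /absk -abszE ltr0n absz_gt0. Qed.

Lemma freq_gt0 (k : int) : k != 0 -> 0 < freq c sigma eps k.
Proof. by move=> k0; rewrite /freq divr_gt0 // !mulr_gt0 // absk_gt0. Qed.

Lemma freq_ge0 (k : int) : 0 <= freq c sigma eps k.
Proof.
have ? : 0 <= absk R k by rewrite /absk ler0z.
by rewrite divr_ge0 ?mulr_ge0 // ltW.
Qed.

Lemma system_mx_sqr (k : int) (S : fourier_system) :
  system_mx c sigma eps k S *m system_mx c sigma eps k S
  = (- freq c sigma eps k)%:C%:M.
Proof.
have sq := sqr_sqrtr (freq_ge0 k).
have e0 : eps != 0 by rewrite gt_eqF.
apply/matrixP=> i j.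
case: S => /=; rewrite !mxE !big_ord_recl big_ord0 !mxE /=;
  case: i => [[|[|//]] ?] /=; case: j => [[|[|//]] ?] /=;
  apply/eqP; rewrite eq_complex /= ?mulr1n ?mulr0n /=; apply/andP; split; apply/eqP;
  try ring: sq; rewrite /freq; by field.
Qed.

Lemma normc_sqr (z : R[i]) :
  ComplexField.Normc.normc z ^+ 2 = complex.Re z ^+ 2 + complex.Im z ^+ 2.
Proof. by case: z => p q /=; rewrite sqr_sqrtr // addr_ge0 ?sqr_ge0. Qed.

(* [system_mx] is skew-adjoint for the inner product of [system_norm]. *)
Lemma system_norm_growth (k : int) (S : fourier_system) (a b : R) (x : 'cV[R[i]]_2) :
  system_norm c sigma eps k S ((a%:C%:M + b%:C *: system_mx c sigma eps k S) *m x)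
  = Num.sqrt (a ^+ 2 + b ^+ 2 * freq c sigma eps k) * system_norm c sigma eps k S x.
Proof.
have sq := sqr_sqrtr (freq_ge0 k).
have e0 : eps != 0 by rewrite gt_eqF.
have c0 : c != 0 by rewrite gt_eqF.
have fE : freq c sigma eps k = c * sigma * absk R k / eps by [].
have D0 : 0 <= a ^+ 2 + b ^+ 2 * freq c sigma eps k.
  exact: addr_ge0 (sqr_ge0 _) (mulr_ge0 (sqr_ge0 _) (freq_ge0 k)).
have i1 : lift ord0 ord0 = 1 :> 'I_2 by apply: val_inj.
case: S; rewrite /system_norm /weighted_norm -sqrtrM //; congr (Num.sqrt _);
  rewrite !normc_sqr !mxE !big_ord_recl !big_ord0 !mxE /= ?mulr1n ?mulr0n /= !i1;
  case: (x 0 0) => p0 q0; case: (x 1 0) => p1 q1 /=.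
all: try by ring: sq.
by rewrite fE; field; rewrite e0 c0.
Qed.
End Systems.

Lemma op_norm_le (R : realType) (a : R) (M : 'M[R[i]]_2) (rho : R) : 0 <= rho ->
  (forall x, weighted_norm a (M *m x) = rho * weighted_norm a x) ->
  op_norm (weighted_norm a) M <= rho.
Proof.
(* The supremum bound needs a nonempty set; x = 0 has norm 0 whatever the weight. *)
move=> rho0 nE; apply: ge_sup.
  exists (weighted_norm a (M *m 0)), 0 => //=.
  by rewrite /weighted_norm !mxE ComplexField.Normc.normc0 expr0n /= mulr0 addr0 sqrtr0.
by move=> _ [x /= x1 <-]; rewrite nE ler_piMr.
Qed.

(** * Square roots of quotients of first-order expansions *)

(** The summand 1 in the smallness condition forces x <= 1, so K x^2 <= K x and N >= 1 - x (|p| +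
    K). *)
Lemma perturbed_one_ge_half (R : realFieldType) (K p x N : R) :
  0 <= K -> 0 < x -> x * (`|p| + K + 1) <= 1 / 2 ->
  `|N - 1 - x * p| <= K * x ^+ 2 -> 1 / 2 <= N.
Proof.
move=> K0 x0 xs /ler_normlP[N1 _].
have xp : - (x * `|p|) <= x * p.
  by rewrite -mulrN ler_pM2l // lerNnormlW.
have x1 : x <= 1 by have := mulr_ge0 (ltW x0) (normr_ge0 p); have := mulr_ge0 (ltW x0) K0; nra.
have : K * x ^+ 2 <= x * K by have : 0 <= x * K; nra.
nra.
Qed.

Lemma sqrt_ratio_lt1 (R : rcfType) (K p q : R) : 0 <= K -> p < q ->
  exists d : R, 0 < d /\ forall x N D : R, 0 < x <= d ->
    `|N - 1 - x * p| <= K * x ^+ 2 -> `|D - 1 - x * q| <= K * x ^+ 2 ->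
    D != 0 /\ Num.sqrt (`|N| / `|D|) < 1.
Proof.
move=> K0 pq.
pose m := `|p| + `|q| + K + 1.
have p0 := normr_ge0 p; have q0 := normr_ge0 q.
have m0 : 0 < m by rewrite /m; lra.
(* The first bound keeps N and D above 1/2. The second gives 2 K x < q - p, hence D - N >= x (q - p
   - 2 K x) > 0. *)
exists (Num.min (1 / 2 / m) ((q - p) / (2 * K + 1))); split.
  by rewrite lt_min !divr_gt0 //; lra.
move=> x N D /andP[x0]; rewrite le_min !ler_pdivlMr //; last lra.
move=> /andP[xm xqp] HN HD.
have N2 : 1 / 2 <= N by apply: (perturbed_one_ge_half K0 x0 _ HN); rewrite /m in xm; nra.
have D2 : 1 / 2 <= D by apply: (perturbed_one_ge_half K0 x0 _ HD); rewrite /m in xm; nra.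
split; first by rewrite gt_eqF //; lra.
rewrite !ger0_norm; try lra.
rewrite -sqrtr1 ltr_sqrt ?ltr01 // ltr_pdivrMr ?mul1r; last lra.
move: HN HD => /ler_normlP[_ HN] /ler_normlP[HD _].
by rewrite expr2 in HN HD; nra.
Qed.

Lemma sqrt_ratio_le (R : rcfType) (K p q : R) : 0 <= K -> q <= p ->
  exists d K' : R, [/\ 0 < d, 0 <= K' & forall x N D : R, 0 < x <= d ->
    `|N - 1 - x * p| <= K * x ^+ 2 -> `|D - 1 - x * q| <= K * x ^+ 2 ->
    D != 0 /\ Num.sqrt (`|N| / `|D|) <= 1 + (p - q) / 2 * x + K' * x ^+ 2].
Proof.
move=> K0 qp.
pose m := `|p| + `|q| + K + 1.
have p0 := normr_ge0 p; have q0 := normr_ge0 q.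
have m0 : 0 < m by rewrite /m; lra.
pose d := p - q; have d0 : 0 <= d by rewrite /d; lra.
have dm : 0 <= d * (`|q| + K) by apply: mulr_ge0; lra.
(* The two errors to absorb: 2 K x^2 from N - D <= d x + 2 K x^2, and d (|q| + K) x^2 from replacing
   d x D by d x. As D >= 1/2, the term 2 K' x^2 D covers both. *)
pose K' := 2 * K + d * (`|q| + K).
have K'0 : 0 <= K' by rewrite /K'; lra.
exists (1 / 2 / m), K'; split => //; first by rewrite !divr_gt0.
move=> x N D /andP[x0]; rewrite ler_pdivlMr // => xm HN HD.
have N2 : 1 / 2 <= N by apply: (perturbed_one_ge_half K0 x0 _ HN); rewrite /m in xm; nra.
have D2 : 1 / 2 <= D by apply: (perturbed_one_ge_half K0 x0 _ HD); rewrite /m in xm; nra.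
split; first by rewrite gt_eqF //; lra.
rewrite !ger0_norm; try lra.
have B0 : 0 <= d / 2 * x + K' * x ^+ 2.
  by rewrite addr_ge0 // mulr_ge0 ?sqr_ge0 //; lra.
rewrite -/d -addrA -[leRHS]ger0_norm -?sqrtr_sqr; last lra.
(* With B = d x / 2 + K' x^2, (1 + B)^2 >= 1 + 2 B, so it suffices to bound N / D by 1 + 2 B. *)
apply: ler_wsqrtr; apply: (@le_trans _ _ (1 + d * x + 2 * K' * x ^+ 2)); last first.
  by have := sqr_ge0 (d / 2 * x + K' * x ^+ 2); rewrite !expr2; lra.
rewrite ler_pdivrMr; last lra.
move: HN HD => /ler_normlP[_ HN] /ler_normlP[HD _].
have xq : - (x * `|q|) <= x * q by rewrite -mulrN ler_pM2l // lerNnormlW.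
have x1 : x <= 1.
  have := mulr_ge0 (ltW x0) p0; have := mulr_ge0 (ltW x0) q0.
  by have := mulr_ge0 (ltW x0) K0; rewrite /m in xm; nra.
have Kx : K * x ^+ 2 <= K * x by rewrite ler_wpM2l // expr2; nra.
have D1 : - ((`|q| + K) * x) <= D - 1 by nra.
have h1 : (d * x) * - ((`|q| + K) * x) <= (d * x) * (D - 1).
  by apply: ler_wpM2l => //; apply: mulr_ge0 => //; apply: ltW.
have h2 : K' * x ^+ 2 <= 2 * K' * x ^+ 2 * D.
  have : 0 <= K' * x ^+ 2 by rewrite mulr_ge0 ?sqr_ge0.
  nra.
by rewrite {1}/K' in h2; rewrite /d in h1 h2 *; lra.
Qed.

(** * Bounds uniform in the modes and grids *)

Section Stability.
Variables (R : realType) (s : nat) (G : 'M[R]_s) (w : 'cV[R]_s).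

(** The right side is the factor of [system_norm_growth] for the matrix of [growth_matrix_sqr]. *)
Lemma psi_stab (tau nu : R) : 0 <= nu ->
  1%:M + (tau ^+ 2 * nu) *: (G *m G) \in unitmx ->
  psi G w tau nu
  = Num.sqrt (stab_re G w (tau ^+ 2 * nu) ^+ 2 + (tau * stab_im G w (tau ^+ 2 * nu)) ^+ 2 * nu).
Proof.
move=> nu0 U; have x0 : 0 <= tau ^+ 2 * nu by rewrite mulr_ge0 ?sqr_ge0.
rewrite /psi -normf_div -growth_factor_sqr //.
rewrite ger0_norm; last exact: addr_ge0 (sqr_ge0 _) (mulr_ge0 x0 (sqr_ge0 _)).
by congr (Num.sqrt _); ring.
Qed.

Variables (c sigma eps : R).
Hypotheses (hc : 0 < c) (hsigma : 0 < sigma) (heps : 0 < eps).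
Local Notation nu := (freq c sigma eps).

(** The system enters the growth factor only through nu, so one scalar bound on [psi] serves all
    three. *)
Lemma growth_le_psi (S : fourier_system) (tau : R) (N : nat) (b : R) :
  (forall k, nonzero_mode N k ->
     1%:M + (tau ^+ 2 * nu k) *: (G *m G) \in unitmx /\ psi G w tau (nu k) <= b) ->
  growth_le G w c sigma eps S tau N b.
Proof.
move=> H k kN; have [U psib] := H k kN.
have nu0 : 0 <= nu k by apply: freq_ge0.
eexists; split.
  by apply: growth_matrix_sqr U; apply: system_mx_sqr.
apply: le_trans psib; rewrite psi_stab //.
have nE := @system_norm_growth _ _ _ _ hc hsigma heps k S
  (stab_re G w (tau ^+ 2 * nu k)) (tau * stab_im G w (tau ^+ 2 * nu k)).
by case: S nE => nE; apply: op_norm_le => //; apply: sqrtr_ge0.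
Qed.

Lemma absk_grid_size (N : nat) (k : int) : (0 < N)%N -> nonzero_mode N k ->
  absk R k * grid_size R N <= pi.
Proof.
move=> N0 [/andP[k1 k2] _].
have kN : `|k| <= (N./2)%:Z.
  by rewrite ler_norml k2 andbT; apply: le_trans k1; rewrite lerDl.
have : absk R k <= (N./2)%:R by rewrite /absk -[leRHS]/((N./2)%:Z%:~R) ler_int.
have : (N./2)%:R * 2 <= N%:R :> R.
  by rewrite -natrM ler_nat muln2 -[leqRHS]odd_double_half leq_addl.
move=> h1 h2; rewrite /grid_size mulrA ler_pdivrMr ?ltr0n //.
have := pi_gt0 R; nra.
Qed.

(** The eps of the CFL condition cancels that of nu: tau |k| / eps <= C h |k| <= C pi. One factor
    tau is left over, so x = tau^2 nu is O(tau) uniformly in k and h. *)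
Lemma cfl_freq_le (C tau : R) (N : nat) (k : int) : 0 < C -> 0 < tau ->
  (0 < N)%N -> tau <= eps * C * grid_size R N -> nonzero_mode N k ->
  tau ^+ 2 * nu k <= c * sigma * C * pi * tau.
Proof.
move=> C0 tau0 N0 cfl kN; have kh := absk_grid_size N0 kN.
have k0 : 0 <= absk R k by rewrite /absk ler0z.
rewrite /freq mulrA ler_pdivrMr // expr2.
have -> : tau * tau * (c * sigma * absk R k) = c * sigma * tau * (absk R k * tau) by ring.
have -> : c * sigma * C * pi * tau * eps = c * sigma * tau * (eps * C * pi) by ring.
rewrite ler_pM2l ?mulr_gt0 //; apply: le_trans (ler_wpM2l k0 cfl) _.
by rewrite mulrCA ler_pM2l // mulr_gt0.
Qed.

(** A single threshold, tau < d / (c sigma C pi), brings x below d for all modes of all admissible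
    grids; x > 0 because k is nonzero. *)
Lemma small_step_freq (C d : R) (P : R -> nat -> Prop) : 0 < C -> 0 < d ->
  (forall tau N, 0 < tau -> (forall k, nonzero_mode N k ->
     [/\ 0 < tau ^+ 2 * nu k, tau ^+ 2 * nu k <= d
       & tau ^+ 2 * nu k <= c * sigma * C * pi * tau]) -> P tau N) ->
  small_step_cfl eps C P.
Proof.
move=> C0 d0 HP.
have X0 : 0 < c * sigma * C * pi by rewrite !mulr_gt0 // pi_gt0.
rewrite /small_step_cfl; near=> tau => N N0 _ cfl.
have tau0 : 0 < tau by near: tau; apply: nbhs_right_gt.
apply: HP => // k kN; have xX := cfl_freq_le C0 tau0 N0 cfl kN.
split => //; first by rewrite mulr_gt0 ?exprn_gt0 ?freq_gt0 //; case: kN.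
apply: le_trans xX _; rewrite mulrC -ler_pdivlMr //; apply: ltW.
by near: tau; apply: nbhs_right_lt; rewrite divr_gt0.
Unshelve. all: by end_near.
Qed.

Lemma small_step_strongly_stable (C : R) : 0 < C ->
  \tr ((G - ones R s *m w^T) *m (G - ones R s *m w^T)) < \tr (G *m G) ->
  small_step_cfl eps C (fun tau N =>
    (forall k, nonzero_mode N k -> psi G w tau (nu k) < 1)
    /\ (forall S, strongly_stable G w c sigma eps S tau N)).
Proof.
move=> C0 trlt; set B := G - _ in trlt.
have [K [K0 HB HG]] := det_1addZ_expansion2 (B *m B) (G *m G).
have [d [d0 Hd]] := sqrt_ratio_lt1 K0 trlt.
(* The cap 1 is the range of validity of the determinant expansions. *)
apply: (small_step_freq (d := Num.min d 1)) => // [|tau N tau0 Hk].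
  by rewrite lt_min d0 ltr01.
have psi1 k : nonzero_mode N k ->
    1%:M + (tau ^+ 2 * nu k) *: (G *m G) \in unitmx /\ psi G w tau (nu k) < 1.
  move=> /Hk[x0]; rewrite le_min => /andP[xd x1] _.
  have x01 : 0 < tau ^+ 2 * nu k <= 1 by rewrite x0.
  have x0d : 0 < tau ^+ 2 * nu k <= d by rewrite x0.
  by have [D0 ?] := Hd _ _ _ x0d (HB _ x01) (HG _ x01); rewrite unitmxE unitfE.
split=> [k /psi1[]//|S]; apply: growth_le_psi => // k /psi1[U /ltW]; by split.
Qed.

Lemma small_step_weakly_stable (C : R) : 0 < C ->
  let B := G - ones R s *m w^T in
  \tr (G *m G) <= \tr (B *m B) ->
  exists K : R, small_step_cfl eps C (fun tau N =>
    let b := 1 + \tr (B *m B - G *m G) * (c * sigma * C * pi / 2) * tau + K * tau ^+ 2 in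
    (forall k, nonzero_mode N k -> psi G w tau (nu k) <= b)
    /\ (forall S, growth_le G w c sigma eps S tau N b)).
Proof.
move=> C0 B trle.
have trB : \tr (B *m B - G *m G) = \tr (B *m B) - \tr (G *m G) by exact: linearB.
have [K [K0 HB HG]] := det_1addZ_expansion2 (B *m B) (G *m G).
have [d [K' [d0 K'0 Hd]]] := sqrt_ratio_le K0 trle.
set X := c * sigma * C * pi.
(* From x <= X tau, the quadratic error K' x^2 is at most K' X^2 tau^2. *)
exists (K' * X ^+ 2); apply: (small_step_freq (d := Num.min d 1)) => // [|tau N tau0 Hk].
  by rewrite lt_min d0 ltr01.
move=> b; suff psib k : nonzero_mode N k ->
    1%:M + (tau ^+ 2 * nu k) *: (G *m G) \in unitmx /\ psi G w tau (nu k) <= b.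
  split=> [k /psib[]//|S]; exact: growth_le_psi.
move=> /Hk[x0]; rewrite le_min => /andP[xd x1] xX.
have x01 : 0 < tau ^+ 2 * nu k <= 1 by rewrite x0.
have x0d : 0 < tau ^+ 2 * nu k <= d by rewrite x0.
have [D0 psile] := Hd _ _ _ x0d (HB _ x01) (HG _ x01).
split; first by rewrite unitmxE unitfE.
apply: le_trans psile _; rewrite /b trB -(mulrA K') -exprMn; apply: lerD.
  rewrite lerD2l -/X; apply: (@le_trans _ _ ((\tr (B *m B) - \tr (G *m G)) / 2 * (X * tau))).
    by rewrite ler_wpM2l // divr_ge0 // subr_ge0.
  by rewrite le_eqVlt; apply/orP; left; apply/eqP; field.
by rewrite ler_wpM2l // lerXn2r ?nnegrE ?(ltW x0) // (le_trans (ltW x0)).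
Qed.

(** The constant is chosen so that y = tau sqrt nu satisfies y^2 <= C1^2 |k| h / pi <= C1^2.
    Membership of i y in the region then yields both |f(i y)| <= 1 and the solvability of the stage
    equations. *)
Lemma stability_region_strongly_stable (C1 : R) : 0 < C1 ->
  [set 0 +i* y | y in [set y : R | - C1 <= y <= C1]] `<=` stability_region G w ->
  forall (tau : R) (N : nat), 0 < tau -> (0 < N)%N ->
    tau <= C1 / Num.sqrt (c * sigma * pi) * Num.sqrt (eps * grid_size R N) ->
    forall S, strongly_stable G w c sigma eps S tau N.
Proof.
move=> C10 segm tau N tau0 N0 cfl S; apply: growth_le_psi => // k kN.
have nu0 := freq_gt0 hc hsigma heps kN.2.
have tn0 : 0 <= tau ^+ 2 * nu k by rewrite mulr_ge0 ?sqr_ge0 // ltW.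
set y := tau * Num.sqrt (nu k).
have yy : y ^+ 2 = tau ^+ 2 * nu k by rewrite exprMn sqr_sqrtr // ltW.
have y0 : 0 <= y by rewrite mulr_ge0 ?sqrtr_ge0 // ltW.
have csp : 0 < c * sigma * pi by rewrite !mulr_gt0 // pi_gt0.
have yC1 : y <= C1.
  rewrite -(@ler_pXn2r _ 2) ?nnegrE // ?(ltW C10) // yy.
  have h0 : 0 < eps * grid_size R N.
    by rewrite mulr_gt0 // divr_gt0 ?ltr0n // mulr_gt0 // pi_gt0.
  have tau2 : tau ^+ 2 <= C1 ^+ 2 / (c * sigma * pi) * (eps * grid_size R N).
    apply: (@le_trans _ _ ((C1 / Num.sqrt (c * sigma * pi) * Num.sqrt (eps * grid_size R N)) ^+ 2)).
      by rewrite lerXn2r ?nnegrE ?(ltW tau0) // (le_trans (ltW tau0)).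
    by rewrite !exprMn exprVn !sqr_sqrtr // ltW.
  apply: le_trans (ler_wpM2r (ltW nu0) tau2) _.
  have -> : C1 ^+ 2 / (c * sigma * pi) * (eps * grid_size R N) * nu k
      = C1 ^+ 2 * ((absk R k * grid_size R N) / pi).
    have pi0 : pi != 0 :> R by rewrite gt_eqF ?pi_gt0.
    by rewrite /freq; move: pi0; move: (@pi R) => p p0; field; rewrite p0 !gt_eqF.
  by rewrite ler_piMr ?sqr_ge0 // ler_pdivrMr ?pi_gt0 // mul1r absk_grid_size.
have [] : stability_region G w (0 +i* y).
  by apply: segm; exists y => //=; rewrite yC1 andbT (le_trans _ y0) // oppr_le0 ltW.
rewrite imag_unitmx yy => U; rewrite rk_fun_imag yy // => f1; split => //.
apply: le_trans f1; rewrite psi_stab ?(ltW nu0) //= ler_wsqrtr //.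
rewrite lerD2l /y [in leRHS]exprMn [in leRHS]exprMn sqr_sqrtr ?(ltW nu0) //.
by rewrite exprMn mulrAC.
Qed.

End Stability.

Theorem theorem2 (R : realType) (s : nat) (G : 'M[R]_s) (w : 'cV[R]_s)
    (c sigma : R) (hc : 0 < c) (hsigma : 0 < sigma) :
  let B := G - ones R s *m w^T in
  (forall C : R, 0 < C -> forall eps : R, 0 < eps <= 1 ->
     [/\ forall S, stable_under_cfl G w c sigma eps C S,
         \tr (B *m B) < \tr (G *m G) ->
           small_step_cfl eps C (fun tau N =>
             (forall k, nonzero_mode N k ->
                psi G w tau (freq c sigma eps k) < 1)
             /\ (forall S, strongly_stable G w c sigma eps S tau N))
       & \tr (G *m G) <= \tr (B *m B) ->
           exists L K : R,
             0 <= L <= \tr (B *m B - G *m G) * (c * sigma * C * pi / (2 * eps))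
             /\ small_step_cfl eps C (fun tau N =>
                  (forall k, nonzero_mode N k ->
                     psi G w tau (freq c sigma eps k)
                       <= 1 + L * tau + K * tau ^+ 2)
                  /\ (forall S, growth_le G w c sigma eps S tau N
                                  (1 + L * tau + K * tau ^+ 2)))])
  /\
  (forall C1 : R, 0 < C1 ->
     [set 0 +i* y | y in [set y : R | - C1 <= y <= C1]]
       `<=` stability_region G w ->
     exists C2 : R, 0 < C2 /\
       forall (eps tau : R) (N : nat), 0 < eps <= 1 -> 0 < tau ->
         (0 < N)%N -> ~~ odd N ->
         tau <= C2 * Num.sqrt (eps * grid_size R N) ->
         forall S, strongly_stable G w c sigma eps S tau N).
Proof.
move=> B; split=> [C C0 eps /andP[eps0 eps1]|C1 C10 segm]; last first.
  exists (C1 / Num.sqrt (c * sigma * pi)); split.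
    by rewrite divr_gt0 // sqrtr_gt0 !mulr_gt0 // pi_gt0.
  move=> eps tau N /andP[eps0 _] tau0 N0 _.
  exact: (stability_region_strongly_stable hc hsigma eps0 C10 segm tau0 N0).
have X0 : 0 < c * sigma * C * pi by rewrite !mulr_gt0 // pi_gt0.
have trB : \tr (B *m B - G *m G) = \tr (B *m B) - \tr (G *m G) by exact: linearB.
split=> [S|trlt|trle].
- have [trlt|trle] := ltP (\tr (B *m B)) (\tr (G *m G)).
    (* Strong stability is the bound with L = K = 0. *)
    exists 0, 0; split=> //.
    apply: filterS (small_step_strongly_stable hc hsigma eps0 C0 trlt).
    move=> tau H N N0 evN cfl k kN; have [_ /(_ S)] := H N N0 evN cfl.
    by move=> /(_ k kN); rewrite !mul0r !addr0.
  have [K HK] := small_step_weakly_stable hc hsigma eps0 C0 trle.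
  exists (\tr (B *m B - G *m G) * (c * sigma * C * pi / 2)), K; split.
    by rewrite trB mulr_ge0 ?subr_ge0 // divr_ge0 // ltW.
  apply: filterS HK => tau H N N0 evN cfl.
  by have [_] := H N N0 evN cfl; apply.
- exact: small_step_strongly_stable.
have [K HK] := small_step_weakly_stable hc hsigma eps0 C0 trle.
(* This L is free of eps; it lies below the stated bound because eps <= 1. *)
exists (\tr (B *m B - G *m G) * (c * sigma * C * pi / 2)), K; split=> //.
have D0 : 0 <= \tr (B *m B - G *m G) by rewrite trB subr_ge0.
rewrite mulr_ge0 ?divr_ge0 ?(ltW X0) //= ler_wpM2l // ler_wpM2l ?(ltW X0) //.
by rewrite lef_pV2 ?posrE ?mulr_gt0 // ler_piMr.
Qed.
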